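(* Let $(\mathscr{C},\otimes,\mathbb{1})$ be a symmetric monoidal category and let $A$ be a rigid commutative algebra in $\mathscr{C}$. The following are equivalent: (i) $A$ is separable; (ii) $A$ is strongly separable; (iii) the trace form of $A$ is nondegenerate.
   Context: $\tau$ denotes the symmetry of $\mathscr{C}$. An algebra in $\mathscr{C}$ is an associative unital monoid $(A,\mu,u)$. It is rigid if its underlying object is rigid (dualizable), i.e. there are an object $DA$ and maps $\eta\colon\mathbb{1}\to DA\otimes A$, $\epsilon\colon A\otimes DA\to\mathbb{1}$ satisfying the triangle identities. $A$ is separable if there is $\sigma\colon A\to A\otimes A$ with $\mu\sigma=\mathrm{id}_A$ and $(1\otimes\mu)(\sigma\otimes1)=\sigma\mu=(\mu\otimes1)(1\otimes\sigma)$; equivalently, if there is $\kappa\colon\mathbb{1}\to A\otimes A$ (a separability idempotent) with $(\kappa1)$ $\mu\kappa=u$ and $(\kappa2)$ $(1\otimes\mu)(\kappa\otimes1)=(\mu\otimes1)(1\otimes\kappa)$ as maps $A\to A\otimes A$. $A$ is strongly separable if there is $\kappa$ satisfying $(\kappa1)$, $(\kappa2)$ and $(\kappa3)$ $\kappa=\tau\kappa$. The trace map of a rigid algebra is the composite $$\mathrm{tr}\colon A\simeq A\otimes\mathbb{1}\xrightarrow{1\otimes\eta}A\otimes DA\otimes A\xrightarrow{1\otimes\tau}A\otimes A\otimes DA\xrightarrow{\mu\otimes1}A\otimes DA\xrightarrow{\epsilon}\mathbb{1},$$ and its trace form is $t=\mathrm{tr}\circ\mu\colon A\otimes A\to\mathbb{1}$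 (a symmetric form: $t=t\tau$). A symmetric form $f\colon A\otimes A\to\mathbb{1}$ is nondegenerate if the adjoint map $f^*\colon A\simeq\mathbb{1}\otimes A\xrightarrow{\eta\otimes1}DA\otimes A\otimes A\xrightarrow{1\otimes f}DA\otimes\mathbb{1}\simeq DA$ is an isomorphism. *)

(* Defs.v *)
From Corelib Require Import ssreflect ssrbool.

Set Implicit Arguments.
Unset Strict Implicit.
Unset Printing Implicit Defensive.

Declare Scope mcat_scope.
Delimit Scope mcat_scope with mcat.
Local Open Scope mcat_scope.

(** Objects and morphisms form types, and equality of morphisms is Leibniz
    equality. Composition is written in applicative order. *)
Record category := Category {
  obj :> Type;
  hom : obj -> obj -> Type;
  idm : forall x, hom x x;
  comp : forall x y z, hom y z -> hom x y -> hom x z;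
  comp_idl : forall x y (f : hom x y), comp (idm y) f = f;
  comp_idr : forall x y (f : hom x y), comp f (idm x) = f;
  comp_assoc : forall w x y z (h : hom y z) (g : hom x y) (f : hom w x),
    comp h (comp g f) = comp (comp h g) f
}.

Arguments hom {c} x y.
Arguments idm {c} x.
Arguments comp {c x y z} g f.

Notation "x ~> y" := (hom x y) (at level 90, y at next level) : mcat_scope.
Notation "g ∘ f" := (comp g f) (at level 45, left associativity) : mcat_scope.
Notation "'id[' x ]" := (idm x) (at level 0, format "'id[' x ]") : mcat_scope.

Definition is_iso (C : category) (x y : C) (f : x ~> y) : Prop :=
  exists g : y ~> x, g ∘ f = id[x] /\ f ∘ g = id[y].

(** Not assumed strict: [assoc], [lunit] and [runit] are the associator and
    the unitors, given together with their inverses. *)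
Record monoidal_category := MonoidalCategory {
  mc_cat :> category;
  one : mc_cat;
  ten : mc_cat -> mc_cat -> mc_cat;
  tenm : forall x x' y y' : mc_cat,
    (x ~> x') -> (y ~> y') -> (ten x y ~> ten x' y');
  tenm_id : forall x y : mc_cat, tenm id[x] id[y] = id[ten x y];
  tenm_comp : forall (x x' x'' y y' y'' : mc_cat)
      (f' : x' ~> x'') (f : x ~> x') (g' : y' ~> y'') (g : y ~> y'),
    tenm (f' ∘ f) (g' ∘ g) = tenm f' g' ∘ tenm f g;

  assoc : forall x y z : mc_cat, ten (ten x y) z ~> ten x (ten y z);
  assoc_inv : forall x y z : mc_cat, ten x (ten y z) ~> ten (ten x y) z;
  assocK : forall x y z, assoc_inv x y z ∘ assoc x y z = id[_];
  assoc_invK : forall x y z, assoc x y z ∘ assoc_inv x y z = id[_];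
  assoc_nat : forall (x x' y y' z z' : mc_cat)
      (f : x ~> x') (g : y ~> y') (h : z ~> z'),
    assoc x' y' z' ∘ tenm (tenm f g) h = tenm f (tenm g h) ∘ assoc x y z;

  lunit : forall x : mc_cat, ten one x ~> x;
  lunit_inv : forall x : mc_cat, x ~> ten one x;
  lunitK : forall x, lunit_inv x ∘ lunit x = id[_];
  lunit_invK : forall x, lunit x ∘ lunit_inv x = id[_];
  lunit_nat : forall (x y : mc_cat) (f : x ~> y),
    lunit y ∘ tenm id[one] f = f ∘ lunit x;

  runit : forall x : mc_cat, ten x one ~> x;
  runit_inv : forall x : mc_cat, x ~> ten x one;
  runitK : forall x, runit_inv x ∘ runit x = id[_];
  runit_invK : forall x, runit x ∘ runit_inv x = id[_];
  runit_nat : forall (x y : mc_cat) (f : x ~> y),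
    runit y ∘ tenm f id[one] = f ∘ runit x;

  pentagon : forall w x y z : mc_cat,
    assoc w x (ten y z) ∘ assoc (ten w x) y z
    = tenm id[w] (assoc x y z) ∘ assoc w (ten x y) z ∘ tenm (assoc w x y) id[z];
  triangle : forall x y : mc_cat,
    tenm id[x] (lunit y) ∘ assoc x one y = tenm (runit x) id[y]
}.

Arguments one {m}.
Arguments ten {m} x y.
Arguments tenm {m x x' y y'} f g.
Arguments assoc {m} x y z.
Arguments assoc_inv {m} x y z.
Arguments lunit {m} x.
Arguments lunit_inv {m} x.
Arguments runit {m} x.
Arguments runit_inv {m} x.

Notation "𝟙" := one (at level 0) : mcat_scope.
Notation "x ⊗ y" := (ten x y) (at level 40, left associativity) : mcat_scope.
Notation "f ⊗₁ g" := (tenm f g) (at level 40, left associativity) : mcat_scope.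

Record symmetric_monoidal_category := SymmetricMonoidalCategory {
  smc_mc :> monoidal_category;
  sym : forall x y : smc_mc, x ⊗ y ~> y ⊗ x;
  sym_nat : forall (x x' y y' : smc_mc) (f : x ~> x') (g : y ~> y'),
    sym x' y' ∘ (f ⊗₁ g) = (g ⊗₁ f) ∘ sym x y;
  symK : forall x y, sym y x ∘ sym x y = id[_];
  hexagon : forall x y z : smc_mc,
    assoc y z x ∘ sym x (y ⊗ z) ∘ assoc x y z
    = (id[y] ⊗₁ sym x z) ∘ assoc y x z ∘ (sym x y ⊗₁ id[z])
}.

Arguments sym {s} x y.

Record algebra (C : monoidal_category) := Algebra {
  carrier :> C;
  alg_mul : carrier ⊗ carrier ~> carrier;
  alg_unit : 𝟙 ~> carrier;
  mul_assoc :
    alg_mul ∘ (alg_mul ⊗₁ id[carrier])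
    = alg_mul ∘ (id[carrier] ⊗₁ alg_mul) ∘ assoc carrier carrier carrier;
  mul_unitl : alg_mul ∘ (alg_unit ⊗₁ id[carrier]) = lunit carrier;
  mul_unitr : alg_mul ∘ (id[carrier] ⊗₁ alg_unit) = runit carrier
}.

Arguments alg_mul {C} a.
Arguments alg_unit {C} a.

Definition commutative (C : symmetric_monoidal_category) (A : algebra C) : Prop :=
  alg_mul A ∘ sym A A = alg_mul A.

Definition separable (C : monoidal_category) (A : algebra C) : Prop :=
  exists sigma : A ~> A ⊗ A,
    [/\ alg_mul A ∘ sigma = id[A],
        (id[A] ⊗₁ alg_mul A) ∘ assoc A A A ∘ (sigma ⊗₁ id[A]) = sigma ∘ alg_mul A
      & sigma ∘ alg_mul A = (alg_mul A ⊗₁ id[A]) ∘ assoc_inv A A A ∘ (id[A] ⊗₁ sigma)].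

Definition separability_idempotent (C : monoidal_category) (A : algebra C)
    (kappa : 𝟙 ~> A ⊗ A) : Prop :=
  alg_mul A ∘ kappa = alg_unit A /\
  (id[A] ⊗₁ alg_mul A) ∘ assoc A A A ∘ (kappa ⊗₁ id[A]) ∘ lunit_inv A
  = (alg_mul A ⊗₁ id[A]) ∘ assoc_inv A A A ∘ (id[A] ⊗₁ kappa) ∘ runit_inv A.

Definition strongly_separable (C : symmetric_monoidal_category) (A : algebra C) : Prop :=
  exists kappa : 𝟙 ~> A ⊗ A,
    separability_idempotent kappa /\ kappa = sym A A ∘ kappa.

(** An object is rigid when this type is inhabited. *)
Record duality (C : monoidal_category) (x : C) := Duality {
  dual : C;
  coev : 𝟙 ~> dual ⊗ x;
  ev : x ⊗ dual ~> 𝟙;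
  duality_triangle :
    lunit x ∘ (ev ⊗₁ id[x]) ∘ assoc_inv x dual x ∘ (id[x] ⊗₁ coev) ∘ runit_inv x
    = id[x];
  duality_triangle_dual :
    runit dual ∘ (id[dual] ⊗₁ ev) ∘ assoc dual x dual ∘ (coev ⊗₁ id[dual])
      ∘ lunit_inv dual
    = id[dual]
}.

Definition trace_map (C : symmetric_monoidal_category) (A : algebra C)
    (D : duality (carrier A)) : A ~> 𝟙 :=
  ev D ∘ (alg_mul A ⊗₁ id[dual D]) ∘ assoc_inv A A (dual D)
    ∘ (id[A] ⊗₁ sym (dual D) A) ∘ (id[A] ⊗₁ coev D) ∘ runit_inv A.

Definition trace_form (C : symmetric_monoidal_category) (A : algebra C)
    (D : duality (carrier A)) : A ⊗ A ~> 𝟙 :=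
  trace_map D ∘ alg_mul A.

Definition adjoint_map (C : monoidal_category) (x : C) (D : duality x)
    (f : x ⊗ x ~> 𝟙) : x ~> dual D :=
  runit (dual D) ∘ (id[dual D] ⊗₁ f) ∘ assoc (dual D) x x
    ∘ (coev D ⊗₁ id[x]) ∘ lunit_inv x.

Definition symmetric_form (C : symmetric_monoidal_category) (x : C)
    (f : x ⊗ x ~> 𝟙) : Prop :=
  f = f ∘ sym x x.

Definition nondegenerate (C : monoidal_category) (x : C) (D : duality x)
    (f : x ⊗ x ~> 𝟙) : Prop :=
  is_iso (adjoint_map D f).

Lemma trace_form_sym (C : symmetric_monoidal_category) (A : algebra C)
    (D : duality (carrier A)) :
  commutative A -> symmetric_form (trace_form D).
Proof.
intro cA. unfold symmetric_form, trace_form.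
now rewrite <- comp_assoc, cA.
Qed.

(* Main.v *)
(* Each morphism [f : x ~> y] acts on right-nested tensor products as a family
   natural in the remaining factor; in this calculus associators and unitors
   become identities, and equations between the families give back equations in
   the category. There, write κ = Σ x_i ⊗ y_i. The product of two separability
   idempotents in A ⊗ A is equal to each of them, so there is at most one, and
   it is symmetric since its swap is one as well. For such κ, a partial trace
   gives Σ tr(x_i) y_i = 1, so κ is a copairing for the trace form. Conversely,
   if the form is nondegenerate then it has a copairing κ, automatically
   symmetric and A-bilinear; since tr(b) is the trace of multiplication by b,
   computed in the dual bases x_i, y_i, it is tr(b Σ x_i y_i), and nondegeneracy
   forces Σ x_i y_i = 1. *)
From Corelib Require Import ssreflect ssrfun ssrbool.
Require Import Defs.

Set Implicit Arguments.
Unset Strict Implicit.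
Unset Printing Implicit Defensive.
Local Open Scope mcat_scope.

(** * Strictification: presentations of tensor products and the families of maps they carry *)

Section Strictification.
Context {C : monoidal_category}.
Implicit Types w x y z : C.

Lemma comp_cancel_iso x y z (i : x ~> y) (j : y ~> x) (f g : y ~> z) :
  i ∘ j = id[y] -> f ∘ i = g ∘ i -> f = g.
Proof.
by move=> ij e; rewrite -(comp_idr f) -(comp_idr g) -ij !comp_assoc e.
Qed.

Lemma cancel_iso_comp x y z (i : x ~> y) (j : y ~> x) (f g : z ~> x) :
  j ∘ i = id[x] -> i ∘ f = i ∘ g -> f = g.
Proof.
by move=> ji e; rewrite -(comp_idl f) -(comp_idl g) -ji -!comp_assoc e.
Qed.

Lemma whiskl_comp a x y z (g : y ~> z) (f : x ~> y) :
  id[a] ⊗₁ (g ∘ f) = (id[a] ⊗₁ g) ∘ (id[a] ⊗₁ f).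
Proof. by rewrite -tenm_comp comp_idl. Qed.

Lemma whiskr_comp a x y z (g : y ~> z) (f : x ~> y) :
  (g ∘ f) ⊗₁ id[a] = (g ⊗₁ id[a]) ∘ (f ⊗₁ id[a]).
Proof. by rewrite -tenm_comp comp_idl. Qed.

Lemma whisk_swap x x' y y' (f : x ~> x') (g : y ~> y') :
  (f ⊗₁ id[y']) ∘ (id[x] ⊗₁ g) = (id[x'] ⊗₁ g) ∘ (f ⊗₁ id[y]).
Proof. by rewrite -!tenm_comp !comp_idl !comp_idr. Qed.

Lemma whiskl_one_inj x y (f g : x ~> y) :
  id[𝟙] ⊗₁ f = id[𝟙] ⊗₁ g -> f = g.
Proof.
move=> e; apply: (comp_cancel_iso (lunit_invK x)).
by rewrite -!lunit_nat e.
Qed.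

Lemma whiskr_one_inj x y (f g : x ~> y) :
  f ⊗₁ id[𝟙] = g ⊗₁ id[𝟙] -> f = g.
Proof.
move=> e; apply: (comp_cancel_iso (runit_invK x)).
by rewrite -!runit_nat e.
Qed.

(* Kelly: after tensoring with 𝟙, this is the pentagon combined with two
   triangles. *)
Lemma lunit_ten x y : lunit (x ⊗ y) ∘ assoc 𝟙 x y = lunit x ⊗₁ id[y].
Proof.
apply: whiskl_one_inj; rewrite whiskl_comp.
have iso_c : (assoc 𝟙 (𝟙 ⊗ x) y ∘ (assoc 𝟙 𝟙 x ⊗₁ id[y])) ∘
   ((assoc_inv 𝟙 𝟙 x ⊗₁ id[y]) ∘ assoc_inv 𝟙 (𝟙 ⊗ x) y) = id[_].
  rewrite comp_assoc -(comp_assoc (assoc _ _ _)) -whiskr_comp assoc_invK.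
  by rewrite tenm_id comp_idr assoc_invK.
apply: (comp_cancel_iso iso_c).
rewrite -[LHS]comp_assoc (comp_assoc (id[𝟙] ⊗₁ assoc 𝟙 x y)) -pentagon.
rewrite !comp_assoc triangle -{1}(tenm_id x y) -assoc_nat -assoc_nat.
by rewrite -comp_assoc -whiskr_comp triangle.
Qed.

(** A presentation of [x] replaces [x ⊗ -] by an isomorphic functor; the ones
    built below turn every bracketed tensor product into a right-nested one. *)
Record pres x := Pres {
  act : C -> C;
  actm : forall w w', (w ~> w') -> (act w ~> act w');
  spread : forall w, x ⊗ w ~> act w;
  gather : forall w, act w ~> x ⊗ w;
  spreadK : forall w, gather w ∘ spread w = id[_];
  gatherK : forall w, spread w ∘ gather w = id[_];
  spread_nat : forall w w' (h : w ~> w'),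
    spread w' ∘ (id[x] ⊗₁ h) = actm h ∘ spread w
}.

Definition pat x : pres x.
refine (@Pres x (fun w => x ⊗ w) (fun w w' h => id[x] ⊗₁ h)
          (fun w => id[_]) (fun w => id[_]) _ _ _).
- by move=> w; rewrite comp_idl.
- by move=> w; rewrite comp_idl.
- by move=> w w' h; rewrite comp_idl comp_idr.
Defined.

Definition pone : pres 𝟙.
refine (@Pres 𝟙 (fun w => w) (fun w w' h => h) lunit lunit_inv _ _ _).
- exact: lunitK.
- exact: lunit_invK.
- exact: lunit_nat.
Defined.

(** Composing the functors forgets the bracketing: both ways of associating three presentations give
    convertible [act], so an associator can be compared with an identity. *)
Definition pten x y (p : pres x) (q : pres y) : pres (x ⊗ y).
refine (@Pres (x ⊗ y) (fun w => act p (act q w))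
   (fun w w' h => actm p (actm q h))
   (fun w => spread p (act q w) ∘ (id[x] ⊗₁ spread q w) ∘ assoc x y w)
   (fun w => assoc_inv x y w ∘ (id[x] ⊗₁ gather q w) ∘ gather p (act q w))
   _ _ _).
- move=> w; rewrite -!comp_assoc (comp_assoc (gather p _)) spreadK comp_idl.
  by rewrite (comp_assoc (id[x] ⊗₁ _)) -whiskl_comp spreadK tenm_id comp_idl assocK.
- move=> w; rewrite -!comp_assoc (comp_assoc (assoc _ _ _)) assoc_invK comp_idl.
  by rewrite (comp_assoc (id[x] ⊗₁ _)) -whiskl_comp gatherK tenm_id comp_idl gatherK.
- move=> w w' h; rewrite -!comp_assoc -tenm_id assoc_nat.
  rewrite (comp_assoc (id[x] ⊗₁ _)) -whiskl_comp spread_nat whiskl_comp.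
  by rewrite !comp_assoc spread_nat.
Defined.

(* Locked, as otherwise [rewrite comp_assoc] unfolds it. *)
Definition hat x y (p : pres x) (q : pres y) (f : x ~> y) w : act p w ~> act q w :=
  locked (spread q w ∘ (f ⊗₁ id[w]) ∘ gather p w).

Section Hat.
Context {x y : C} (p : pres x) (q : pres y).

Lemma hat_spread (f : x ~> y) w :
  hat p q f w ∘ spread p w = spread q w ∘ (f ⊗₁ id[w]).
Proof. by rewrite /hat -lock -!comp_assoc spreadK comp_idr. Qed.

Lemma hat_unique (f : x ~> y) w (h : act p w ~> act q w) :
  h ∘ spread p w = spread q w ∘ (f ⊗₁ id[w]) -> hat p q f w = h.
Proof.
by move=> e; apply: (comp_cancel_iso (gatherK p w)); rewrite hat_spread e.
Qed.

(** The component at [𝟙] alone decides, since tensoring with [𝟙] is faithful; this brings equations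
    between families back to the category. *)
Lemma hat_inj (f g : x ~> y) : (forall w, hat p q f w = hat p q g w) -> f = g.
Proof.
move=> e; apply: whiskr_one_inj.
apply: (cancel_iso_comp (spreadK q 𝟙)); rewrite -!hat_spread.
by rewrite e.
Qed.

End Hat.

Section HatLaws.
Context {x y z : C} (p : pres x) (q : pres y) (r : pres z).

Lemma hat_id w : hat p p id[x] w = id[_].
Proof. by apply: hat_unique; rewrite tenm_id comp_idl comp_idr. Qed.

Lemma hat_comp (g : y ~> z) (f : x ~> y) w :
  hat p r (g ∘ f) w = hat q r g w ∘ hat p q f w.
Proof.
apply: hat_unique.
by rewrite -comp_assoc hat_spread comp_assoc hat_spread whiskr_comp comp_assoc.
Qed.

Lemma hat_nat (f : x ~> y) w w' (h : w ~> w') :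
  hat p q f w' ∘ actm p h = actm q h ∘ hat p q f w.
Proof.
apply: (comp_cancel_iso (gatherK p w)).
rewrite -!comp_assoc hat_spread -[actm p h ∘ _]spread_nat !comp_assoc hat_spread.
by rewrite -spread_nat -!comp_assoc whisk_swap.
Qed.

(** Unfolding the presentations turns this into the pentagon, by naturality of the associator. *)
Lemma hat_assoc w :
  hat (pten (pten p q) r) (pten p (pten q r)) (assoc x y z) w
  = id[act p (act q (act r w))].
Proof.
apply: hat_unique; rewrite /= comp_idl.
rewrite -!comp_assoc -tenm_id (comp_assoc (assoc x y _)) assoc_nat.
rewrite !whiskl_comp -!comp_assoc pentagon; congr (_ ∘ (_ ∘ _)).
by rewrite -!comp_assoc.
Qed.

Lemma hat_lunit w : hat (pten pone p) p (lunit x) w = id[act p w].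
Proof.
apply: hat_unique; rewrite /= comp_idl.
by rewrite lunit_nat -comp_assoc lunit_ten.
Qed.

Lemma hat_runit w : hat (pten p pone) p (runit x) w = id[act p w].
Proof.
by apply: hat_unique; rewrite /= comp_idl -comp_assoc triangle.
Qed.

End HatLaws.

Lemma hat_inv x y (p : pres x) (q : pres y) (f : x ~> y) (g : y ~> x) w :
  g ∘ f = id[x] -> hat q p g w ∘ hat p q f w = id[_].
Proof. by move=> e; rewrite -hat_comp e hat_id. Qed.

Lemma hat_assoc_inv x y z (p : pres x) (q : pres y) (r : pres z) w :
  hat (pten p (pten q r)) (pten (pten p q) r) (assoc_inv x y z) w
  = id[act p (act q (act r w))].
Proof.
have := hat_inv (pten (pten p q) r) (pten p (pten q r)) w (assocK x y z).
by rewrite hat_assoc comp_idr.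
Qed.

Lemma hat_lunit_inv x (p : pres x) w :
  hat p (pten pone p) (lunit_inv x) w = id[act p w].
Proof.
have := hat_inv (pten pone p) p w (lunitK x).
by rewrite hat_lunit comp_idr.
Qed.

Lemma hat_runit_inv x (p : pres x) w :
  hat p (pten p pone) (runit_inv x) w = id[act p w].
Proof.
have := hat_inv (pten p pone) p w (runitK x).
by rewrite hat_runit comp_idr.
Qed.

Lemma hat_whiskl x y z (p : pres x) (q : pres y) (r : pres z) (f : y ~> z) w :
  hat (pten p q) (pten p r) (id[x] ⊗₁ f) w = actm p (hat q r f w).
Proof.
apply: hat_unique => /=.
rewrite -!comp_assoc assoc_nat !comp_assoc -spread_nat; congr (_ ∘ _).
by rewrite -!comp_assoc -!whiskl_comp hat_spread.
Qed.

Lemma hat_whiskr x y z (p : pres x) (q : pres y) (r : pres z) (f : x ~> y) w :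
  hat (pten p r) (pten q r) (f ⊗₁ id[z]) w = hat p q f (act r w).
Proof.
apply: hat_unique => /=.
rewrite !comp_assoc hat_spread -!comp_assoc assoc_nat tenm_id.
by rewrite !(comp_assoc _ _ (assoc _ _ _)) whisk_swap.
Qed.

End Strictification.

(** * The symmetry in the strict calculus *)

Section Braiding.
Context {C : symmetric_monoidal_category}.
Implicit Types w x y z : C.

Definition braid x y (p : pres x) (q : pres y) w :
    act p (act q w) ~> act q (act p w) :=
  hat (pten p q) (pten q p) (sym x y) w.

Section Laws.
Context {x y z : C} (p : pres x) (q : pres y) (r : pres z).

Lemma braidK w : braid q p w ∘ braid p q w = id[_].
Proof. exact: (hat_inv (pten p q) (pten q p) w (symK x y)). Qed.

(** The hexagon with its associators turned into identities. *)
Lemma braid_ten w :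
  braid p (pten q r) w = actm q (braid p r w) ∘ braid p q (act r w).
Proof.
have := congr1 (fun f => hat (pten (pten p q) r) (pten q (pten r p)) f w)
               (hexagon x y z).
rewrite (hat_comp _ (pten p (pten q r))) hat_assoc.
rewrite (hat_comp _ (pten (pten q r) p)) hat_assoc.
rewrite (hat_comp _ (pten (pten q p) r)) hat_whiskr.
rewrite (hat_comp _ (pten q (pten p r))) hat_whiskl hat_assoc.
by rewrite comp_idl !comp_idr.
Qed.

Lemma braid_nat (f : y ~> z) w :
  braid p r w ∘ actm p (hat q r f w) = hat q r f (act p w) ∘ braid p q w.
Proof.
have := congr1 (fun f => hat (pten p q) (pten r p) f w) (sym_nat id[x] f).
rewrite (hat_comp _ (pten p r)) (hat_comp _ (pten q p)).
by rewrite hat_whiskl hat_whiskr.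
Qed.

End Laws.

Lemma braid_nat_l x y z (p : pres x) (q : pres y) (r : pres z) (f : y ~> z) w :
  braid r p w ∘ hat q r f (act p w) = actm p (hat q r f w) ∘ braid q p w.
Proof.
have := congr1 (fun f => hat (pten q p) (pten p r) f w) (sym_nat f id[x]).
rewrite (hat_comp _ (pten r p)) (hat_comp _ (pten p q)).
by rewrite hat_whiskl hat_whiskr.
Qed.

(* The hexagon at 𝟙 ⊗ 𝟙 makes the braiding with 𝟙 idempotent, and it is
   invertible. *)
Lemma braid_one x (p : pres x) w : braid p pone w = id[act p w].
Proof.
have e := braid_nat p (pten pone pone) pone (lunit 𝟙) w.
rewrite braid_ten !hat_lunit /= comp_idl in e.
have b1 := braidK p pone w.
have e1 : actm p id[w] = id[act p w].
  apply: (comp_cancel_iso (gatherK p w)).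
  by rewrite -spread_nat tenm_id comp_idl comp_idr.
move: e; rewrite e1 comp_idr /= => e.
by rewrite -b1 {2}e comp_assoc b1 comp_idl.
Qed.

End Braiding.

(** * Right-nested string calculus *)

Local Notation "x ◁ f" := (id[x] ⊗₁ f) (at level 39, right associativity).

Ltac nrm H :=
  rewrite ?whiskl_comp -?comp_assoc ?tenm_id ?comp_idl ?comp_idr in H.

(* [rw E] rewrites with [E : l = r] inside a composite, whatever the bracketing,
   by also trying [forall v, l ∘ v = r ∘ v]. *)
Ltac rw E :=
  let T := type of E in
  lazymatch T with
  | @eq (hom ?x ?y) ?l ?r =>
    let H := fresh in
    rewrite ?whiskl_comp -?comp_assoc ?tenm_id ?comp_idl ?comp_idr;
    first [ pose proof (fun z (v : hom z x) =>
              ltac:(let K := fresh in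
                    have K := congr1 (fun h => comp h v) E;
                    cbv beta in K; nrm K; exact K)) as H;
            rewrite H
          | have H := E; nrm H; rewrite H ];
    clear H;
    rewrite ?whiskl_comp -?comp_assoc ?tenm_id ?comp_idl ?comp_idr
  end.
Ltac rwl E := rw (esym E).

Lemma whiskl_eq (C : monoidal_category) (a x y : C) (f g : x ~> y) :
  f = g -> a ◁ f = a ◁ g.
Proof. by move->. Qed.

Section Calculus.
Context {C : symmetric_monoidal_category}.
Implicit Types a w x y z : C.

(** First of the generators of the calculus: each acts on the leading factors, [w] stands for all
    strings to the right, and [◁] moves a generator past further strings on its left. *)
Definition cap x y (k : 𝟙 ~> x ⊗ y) w : w ~> x ⊗ (y ⊗ w) :=
  hat pone (pten (pat x) (pat y)) k w.
Definition cup x y (e : x ⊗ y ~> 𝟙) w : x ⊗ (y ⊗ w) ~> w :=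
  hat (pten (pat x) (pat y)) pone e w.
Definition mul x y z (m : x ⊗ y ~> z) w : x ⊗ (y ⊗ w) ~> z ⊗ w :=
  hat (pten (pat x) (pat y)) (pat z) m w.
Definition comul x y z (s : x ~> y ⊗ z) w : x ⊗ w ~> y ⊗ (z ⊗ w) :=
  hat (pat x) (pten (pat y) (pat z)) s w.
Definition unit x (u : 𝟙 ~> x) w : w ~> x ⊗ w := hat pone (pat x) u w.
Definition counit x (t : x ~> 𝟙) w : x ⊗ w ~> w := hat (pat x) pone t w.
Definition map x y (f : x ~> y) w : x ⊗ w ~> y ⊗ w := hat (pat x) (pat y) f w.
Definition swap x y w : x ⊗ (y ⊗ w) ~> y ⊗ (x ⊗ w) := braid (pat x) (pat y) w.

Lemma cap_nat x y (k : 𝟙 ~> x ⊗ y) w w' (h : w ~> w') :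
  cap k w' ∘ h = x ◁ y ◁ h ∘ cap k w.
Proof. exact: (hat_nat pone (pten (pat x) (pat y)) k h). Qed.

Lemma cup_nat x y (e : x ⊗ y ~> 𝟙) w w' (h : w ~> w') :
  cup e w' ∘ x ◁ y ◁ h = h ∘ cup e w.
Proof. exact: (hat_nat (pten (pat x) (pat y)) pone e h). Qed.

Lemma mul_nat x y z (m : x ⊗ y ~> z) w w' (h : w ~> w') :
  mul m w' ∘ x ◁ y ◁ h = z ◁ h ∘ mul m w.
Proof. exact: (hat_nat (pten (pat x) (pat y)) (pat z) m h). Qed.

Lemma unit_nat x (u : 𝟙 ~> x) w w' (h : w ~> w') :
  unit u w' ∘ h = x ◁ h ∘ unit u w.
Proof. exact: (hat_nat pone (pat x) u h). Qed.

Lemma counit_nat x (t : x ~> 𝟙) w w' (h : w ~> w') :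
  counit t w' ∘ x ◁ h = h ∘ counit t w.
Proof. exact: (hat_nat (pat x) pone t h). Qed.

Lemma map_nat x y (f : x ~> y) w w' (h : w ~> w') :
  map f w' ∘ x ◁ h = y ◁ h ∘ map f w.
Proof. exact: (hat_nat (pat x) (pat y) f h). Qed.

Lemma swap_nat x y w w' (h : w ~> w') :
  swap x y w' ∘ x ◁ y ◁ h = y ◁ x ◁ h ∘ swap x y w.
Proof. exact: (hat_nat (pten (pat x) (pat y)) (pten (pat y) (pat x)) (sym x y) h). Qed.

Lemma swapK x y w : swap y x w ∘ swap x y w = id[_].
Proof. exact: (braidK (pat x) (pat y) w). Qed.

(** Naturality of the braiding in the copairing: a string crossing both legs slides off, because its
    crossing with [𝟙] is trivial. *)
Lemma swap_cap a x y (k : 𝟙 ~> x ⊗ y) w :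
  x ◁ swap a y w ∘ swap a x (y ⊗ w) ∘ a ◁ cap k w = cap k (a ⊗ w).
Proof.
have := braid_nat (pat a) pone (pten (pat x) (pat y)) k w.
by rewrite braid_ten braid_one comp_idr.
Qed.

Lemma swap_cap_r a x y (k : 𝟙 ~> x ⊗ y) w :
  swap x a (y ⊗ w) ∘ x ◁ swap y a w ∘ cap k (a ⊗ w) = a ◁ cap k w.
Proof.
rewrite -swap_cap -!comp_assoc (comp_assoc (x ◁ _)) -whiskl_comp swapK tenm_id.
by rewrite comp_idl comp_assoc swapK comp_idl.
Qed.

Lemma swap_cup a x y (e : x ⊗ y ~> 𝟙) w :
  a ◁ cup e w = cup e (a ⊗ w) ∘ x ◁ swap a y w ∘ swap a x (y ⊗ w).
Proof.
have := braid_nat (pat a) (pten (pat x) (pat y)) pone e w.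
by rewrite braid_ten braid_one comp_idl -comp_assoc.
Qed.

Lemma swap_counit a x (t : x ~> 𝟙) w :
  a ◁ counit t w = counit t (a ⊗ w) ∘ swap a x w.
Proof.
have := braid_nat (pat a) (pat x) pone t w.
by rewrite braid_one comp_idl.
Qed.

Lemma swap_mul a x y z (m : x ⊗ y ~> z) w :
  swap a z w ∘ a ◁ mul m w
  = mul m (a ⊗ w) ∘ x ◁ swap a y w ∘ swap a x (y ⊗ w).
Proof.
have := braid_nat (pat a) (pten (pat x) (pat y)) (pat z) m w.
by rewrite braid_ten -comp_assoc.
Qed.

Lemma swap_mul_r a x y z (m : x ⊗ y ~> z) w :
  swap z a w ∘ mul m (a ⊗ w)
  = a ◁ mul m w ∘ swap x a (y ⊗ w) ∘ x ◁ swap y a w.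
Proof.
have K : x ◁ swap a y w ∘ swap a x (y ⊗ w) ∘ swap x a (y ⊗ w) ∘ x ◁ swap y a w
         = id[_].
  by rewrite -(comp_assoc (x ◁ _)) swapK comp_idr -whiskl_comp swapK tenm_id.
rewrite -[mul m (a ⊗ w)]comp_idr -K !comp_assoc.
rewrite -(comp_assoc (swap z a w)) -(comp_assoc (swap z a w)) -swap_mul.
by rewrite (comp_assoc (swap z a w)) swapK comp_idl.
Qed.

Lemma swap_map a x y (f : x ~> y) w :
  swap y a w ∘ map f (a ⊗ w) = a ◁ map f w ∘ swap x a w.
Proof. exact: (braid_nat_l (pat a) (pat x) (pat y) f w). Qed.

(** The Yang-Baxter equation, obtained as naturality of the braiding with respect to a crossing. *)
Lemma swap_braid a x y w :
  y ◁ swap a x w ∘ swap a y (x ⊗ w) ∘ a ◁ swap x y w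
  = swap x y (a ⊗ w) ∘ x ◁ swap a y w ∘ swap a x (y ⊗ w).
Proof.
have := braid_nat (pat a) (pten (pat x) (pat y)) (pten (pat y) (pat x))
          (sym x y) w.
by rewrite !braid_ten -(comp_assoc (swap x y _)).
Qed.

End Calculus.

(** * Separability idempotents and the trace form *)

Section Trace.
Context {C : symmetric_monoidal_category} (A : algebra C).
Context (commA : commutative A) (D : duality (carrier A)).
Notation D' := (dual D).
Notation m := (mul (alg_mul A)).
Notation u := (unit (alg_unit A)).
Notation s := (swap (carrier A) (carrier A)).

Lemma m_assoc w : m w ∘ m (A ⊗ w) = m w ∘ A ◁ m w.
Proof.
set a := pat (carrier A).
have := congr1 (fun f => hat (pten (pten a a) a) a f w) (mul_assoc A).
rewrite (hat_comp _ (pten a a)) hat_whiskr (hat_comp _ (pten a (pten a a))).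
by rewrite hat_assoc comp_idr (hat_comp _ (pten a a)) hat_whiskl.
Qed.

Lemma m_unitl w : m w ∘ u (A ⊗ w) = id[_].
Proof.
set a := pat (carrier A).
have := congr1 (fun f => hat (pten pone a) a f w) (mul_unitl A).
by rewrite (hat_comp _ (pten a a)) hat_whiskr hat_lunit.
Qed.

Lemma m_unitr w : m w ∘ A ◁ u w = id[_].
Proof.
set a := pat (carrier A).
have := congr1 (fun f => hat (pten a pone) a f w) (mul_unitr A).
by rewrite (hat_comp _ (pten a a)) hat_whiskl hat_runit.
Qed.

Lemma m_comm w : m w ∘ s w = m w.
Proof.
set a := pat (carrier A).
have := congr1 (fun f => hat (pten a a) a f w) commA.
by rewrite (hat_comp _ (pten a a)).
Qed.

Lemma sep_idemP (k : 𝟙 ~> A ⊗ A) :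
  separability_idempotent k <->
  (forall w, m w ∘ cap k w = u w) /\
  (forall w, A ◁ m w ∘ cap k (A ⊗ w) = m (A ⊗ w) ∘ A ◁ cap k w).
Proof.
set a := pat (carrier A).
have h1 w : hat pone a (alg_mul A ∘ k) w = m w ∘ cap k w.
  by rewrite (hat_comp _ (pten a a)).
have h2 w : hat a (pten a a) ((id[A] ⊗₁ alg_mul A) ∘ assoc A A A
       ∘ (k ⊗₁ id[A]) ∘ lunit_inv A) w = A ◁ m w ∘ cap k (A ⊗ w).
  rewrite (hat_comp _ (pten pone a)) hat_lunit_inv comp_idr.
  rewrite (hat_comp _ (pten (pten a a) a)) hat_whiskr.
  by rewrite (hat_comp _ (pten a (pten a a))) hat_assoc comp_idr hat_whiskl.
have h3 w : hat a (pten a a) ((alg_mul A ⊗₁ id[A]) ∘ assoc_inv A A A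
       ∘ (id[A] ⊗₁ k) ∘ runit_inv A) w = m (A ⊗ w) ∘ A ◁ cap k w.
  rewrite (hat_comp _ (pten a pone)) hat_runit_inv comp_idr.
  rewrite (hat_comp _ (pten a (pten a a))) hat_whiskl.
  by rewrite (hat_comp _ (pten (pten a a) a)) hat_assoc_inv comp_idr hat_whiskr.
split=> [[e1 e2]|[e1 e2]]; split.
- by move=> w; rewrite -h1 e1.
- by move=> w; rewrite -h2 -h3 e2.
- by apply: (hat_inj (p := pone) (q := a)) => w; rewrite h1 e1.
- by apply: (hat_inj (p := a) (q := pten a a)) => w; rewrite h2 h3 e2.
Qed.

Lemma cap_sym (k : 𝟙 ~> A ⊗ A) w : cap (sym A A ∘ k) w = s w ∘ cap k w.
Proof. by rewrite /cap (hat_comp _ (pten (pat A) (pat A))). Qed.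

(** The passage is κ = σu in one direction and σ = (1 ⊗ μ)(κ ⊗ 1) in the other. *)
Lemma separableP :
  separable A <-> exists k : 𝟙 ~> A ⊗ A, separability_idempotent k.
Proof.
set a := pat (carrier A).
have h1 (sg : A ~> A ⊗ A) w : hat a a (alg_mul A ∘ sg) w = m w ∘ comul sg w.
  by rewrite (hat_comp _ (pten a a)).
have h2 (sg : A ~> A ⊗ A) w : hat (pten a a) (pten a a)
   ((id[A] ⊗₁ alg_mul A) ∘ assoc A A A ∘ (sg ⊗₁ id[A])) w
   = A ◁ m w ∘ comul sg (A ⊗ w).
  rewrite (hat_comp _ (pten (pten a a) a)) hat_whiskr.
  by rewrite (hat_comp _ (pten a (pten a a))) hat_assoc comp_idr hat_whiskl.
have h3 (sg : A ~> A ⊗ A) w : hat (pten a a) (pten a a)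
   ((alg_mul A ⊗₁ id[A]) ∘ assoc_inv A A A ∘ (id[A] ⊗₁ sg)) w
   = m (A ⊗ w) ∘ A ◁ comul sg w.
  rewrite (hat_comp _ (pten a (pten a a))) hat_whiskl.
  by rewrite (hat_comp _ (pten (pten a a) a)) hat_assoc_inv comp_idr hat_whiskr.
have h4 (sg : A ~> A ⊗ A) w :
   hat (pten a a) (pten a a) (sg ∘ alg_mul A) w = comul sg w ∘ m w.
  by rewrite (hat_comp _ a).
split=> [[sg [s1 s2 s3]]|[k /sep_idemP[k1 k2]]].
- have e1 w : m w ∘ comul sg w = id[_] by rewrite -h1 s1 hat_id.
  have e2 w : A ◁ m w ∘ comul sg (A ⊗ w) = comul sg w ∘ m w.
    by rewrite -h2 s2 h4.
  have e3 w : comul sg w ∘ m w = m (A ⊗ w) ∘ A ◁ comul sg w.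
    by rewrite -h3 -s3 h4.
  exists (sg ∘ alg_unit A); apply/sep_idemP.
  have ck w : cap (sg ∘ alg_unit A) w = comul sg w ∘ u w.
    by rewrite /cap (hat_comp _ a).
  split=> w; rewrite !ck; first by rw (e1 w).
  (* Both sides of (κ2) reduce to σ by the unit laws. *)
  by rw (e2 w); rw (m_unitl w); rwl (e3 w); rw (m_unitr w).
- pose sg := (id[A] ⊗₁ alg_mul A) ∘ assoc A A A ∘ (k ⊗₁ id[A]) ∘ lunit_inv A.
  have sgE w : comul sg w = A ◁ m w ∘ cap k (A ⊗ w).
    rewrite /comul /sg (hat_comp _ (pten pone a)) hat_lunit_inv comp_idr.
    rewrite (hat_comp _ (pten (pten a a) a)) hat_whiskr.
    by rewrite (hat_comp _ (pten a (pten a a))) hat_assoc comp_idr hat_whiskl.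
  exists sg; split.
  + apply: (hat_inj (p := a) (q := a)) => w; rewrite h1 hat_id sgE.
    by rwl (m_assoc w); rw (k1 (A ⊗ w)); rw (m_unitl w).
  + apply: (hat_inj (p := pten a a) (q := pten a a)) => w.
    rewrite h2 h4 !sgE; rw (whiskl_eq A (m_assoc w)).
    by rw (cap_nat k (m w)).
  + apply: (hat_inj (p := pten a a) (q := pten a a)) => w.
    rewrite h3 h4 !sgE; rw (k2 w); rw (whiskl_eq A (k2 w)).
    by rwl (m_assoc (A ⊗ w)); rw (mul_nat (alg_mul A) (cap k w)).
Qed.

(* In the commutative ring A ⊗ A, the product of two separability idempotents
   is [m ⊗ m] applied to their nesting; it equals the inner one. *)
Lemma sep_idem_absorb (k l : 𝟙 ~> A ⊗ A) w :
  separability_idempotent k -> separability_idempotent l ->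
  m (A ⊗ w) ∘ A ◁ A ◁ m w ∘ A ◁ cap l (A ⊗ w) ∘ cap k w = cap l w.
Proof.
move=> /sep_idemP[k1 _] /sep_idemP[_ l2].
rw (whiskl_eq A (l2 w)); rwl (m_assoc (A ⊗ w)).
by rw (mul_nat (alg_mul A) (cap l w)); rw (k1 w); rwl (unit_nat (alg_unit A) (cap l w));
  rw (m_unitl (A ⊗ w)).
Qed.

(** Crossing the first two and the last two of the four strings exchanges the inner and the outer
    copairing; a commutative multiplication absorbs both crossings, so the products kl and lk
    agree. *)
Lemma swap_nested (k l : 𝟙 ~> A ⊗ A) w :
  A ◁ A ◁ s w ∘ s (A ⊗ (A ⊗ w)) ∘ A ◁ cap l (A ⊗ w) ∘ cap k w
  = A ◁ cap k (A ⊗ w) ∘ cap l w.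
Proof.
have e : s (A ⊗ (A ⊗ w)) ∘ A ◁ cap l (A ⊗ w)
         = A ◁ s (A ⊗ w) ∘ cap l (A ⊗ (A ⊗ w)).
  rwl (swap_cap A l (A ⊗ w)); rw (whiskl_eq A (swapK A A (A ⊗ w))).
  by [].
rw e; rw (cap_nat l (cap k w)); rwl (swap_cap A k w).
by [].
Qed.

Lemma sep_idem_unique (k l : 𝟙 ~> A ⊗ A) :
  separability_idempotent k -> separability_idempotent l -> k = l.
Proof.
move=> sk sl; apply: (hat_inj (p := pone) (q := pten (pat A) (pat A))) => w.
rewrite -[LHS]/(cap k w) -[RHS]/(cap l w).
(* Each idempotent becomes the product in which it is the inner factor. *)
rewrite -[LHS](sep_idem_absorb w sl sk) -[RHS](sep_idem_absorb w sk sl).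
rwl (swap_nested k l w); rw (whiskl_eq A (whiskl_eq A (m_comm w))).
by rwl (swap_nat A A (m w)); rw (m_comm (A ⊗ w)).
Qed.

Lemma sep_idem_sym (k : 𝟙 ~> A ⊗ A) :
  separability_idempotent k -> separability_idempotent (sym A A ∘ k).
Proof.
move=> /sep_idemP[k1 k2]; apply/sep_idemP.
split=> w; rewrite !cap_sym; first by rw (m_comm w); rw (k1 w).
have yb := swap_braid A A A w.
have ss := swapK A A (A ⊗ w).
have lss := whiskl_eq A (swapK A A w).
(* Postcomposing (κ2) for [k] with the swap exchanges its two sides, up to Yang-Baxter and
   commutativity. *)
have e := congr1 (fun f => s w ∘ f) (k2 w); cbv beta in e; move: e.
rw (swap_mul A (alg_mul A) w); rwl (swap_cap A k w).
rwl (m_comm (A ⊗ w)); rwl yb; rw lss; rw ss.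
rw (swap_mul_r A (alg_mul A) w); rwl (whiskl_eq A (m_comm w)); rw yb.
by move=> ->.
Qed.

Lemma sep_idem_fix (k : 𝟙 ~> A ⊗ A) :
  separability_idempotent k -> k = sym A A ∘ k.
Proof. by move=> sk; apply: sep_idem_unique => //; apply: sep_idem_sym. Qed.

(** * Duality and the trace form; [c] is the coevaluation with its legs exchanged *)

Notation coev_ := (cap (coev D)).
Notation ev_ := (cup (ev D)).
Notation sAD := (swap (carrier A) D').
Notation sDA := (swap D' (carrier A)).
Notation c := (cap (sym D' A ∘ coev D)).
Notation tr := (counit (trace_map D)).
Notation t := (cup (trace_form D)).
Notation adj := (map (adjoint_map D (trace_form D))).

Lemma zigzag w : ev_ (A ⊗ w) ∘ A ◁ coev_ w = id[_].
Proof.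
set a := pat (carrier A); set d := pat D'.
have := congr1 (fun f => hat a a f w) (duality_triangle D).
rewrite hat_id (hat_comp _ (pten a pone)) hat_runit_inv comp_idr.
rewrite (hat_comp _ (pten a (pten d a))) hat_whiskl.
rewrite (hat_comp _ (pten (pten a d) a)) hat_assoc_inv comp_idr.
by rewrite (hat_comp _ (pten pone a)) hat_lunit comp_idl hat_whiskr.
Qed.

Lemma zigzag_dual w : D' ◁ ev_ w ∘ coev_ (D' ⊗ w) = id[_].
Proof.
set a := pat (carrier A); set d := pat D'.
have := congr1 (fun f => hat d d f w) (duality_triangle_dual D).
rewrite hat_id (hat_comp _ (pten pone d)) hat_lunit_inv comp_idr.
rewrite (hat_comp _ (pten (pten d a) d)) hat_whiskr.
rewrite (hat_comp _ (pten d (pten a d))) hat_assoc comp_idr.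
by rewrite (hat_comp _ (pten d pone)) hat_runit comp_idl hat_whiskl.
Qed.

Lemma coev_swap w : c w = sDA w ∘ coev_ w.
Proof. by rewrite /cap (hat_comp _ (pten (pat D') (pat A))). Qed.

Lemma trace_coev w : tr w = ev_ w ∘ m (D' ⊗ w) ∘ A ◁ c w.
Proof.
rewrite coev_swap whiskl_comp comp_assoc.
set a := pat (carrier A); set d := pat D'.
rewrite /counit /trace_map.
rewrite (hat_comp _ (pten a pone)) hat_runit_inv comp_idr.
rewrite (hat_comp _ (pten a (pten d a))) hat_whiskl.
rewrite (hat_comp _ (pten a (pten a d))) hat_whiskl.
rewrite (hat_comp _ (pten (pten a a) d)) hat_assoc_inv comp_idr.
by rewrite (hat_comp _ (pten a d)) hat_whiskr.
Qed.

Lemma form_trace w : t w = tr w ∘ m w.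
Proof. by rewrite /cup (hat_comp _ (pat A)). Qed.

Lemma adj_form w : adj w = D' ◁ t w ∘ coev_ (A ⊗ w).
Proof.
set a := pat (carrier A); set d := pat D'.
rewrite /map /adjoint_map.
rewrite (hat_comp _ (pten pone a)) hat_lunit_inv comp_idr.
rewrite (hat_comp _ (pten (pten d a) a)) hat_whiskr.
rewrite (hat_comp _ (pten d (pten a a))) hat_assoc comp_idr.
by rewrite (hat_comp _ (pten d pone)) hat_runit comp_idl hat_whiskl.
Qed.

(** * From a separability idempotent to nondegeneracy *)

Section FromIdempotent.
Context (k : 𝟙 ~> A ⊗ A) (sk : separability_idempotent k).

(* [tr] of the first factor of [k] is the partial trace of [b ↦ (b ⊗ 1) k]; by
   (κ2) this map is [b ↦ k (1 ⊗ b)], whose partial trace is [m k]. *)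
Lemma tr_sep_idem w : tr (A ⊗ w) ∘ cap k w = u w.
Proof.
have [k1 k2] := proj1 (sep_idemP k) sk.
(* By commutativity, the [A]-leg of the coevaluation may be multiplied from either side. *)
have e w' : sAD w' ∘ m (D' ⊗ w') ∘ A ◁ c w' = D' ◁ m w' ∘ coev_ (A ⊗ w').
  rwl (swap_cap_r A (sym D' A ∘ coev D) w'); rw (m_comm (D' ⊗ w')).
  rw (swap_mul_r D' (alg_mul A) w'); rw (whiskl_eq A (swapK D' A w')).
  by rewrite coev_swap; rw (swapK D' A (A ⊗ w')).
rewrite trace_coev; rwl (swap_cap_r A (sym D' A ∘ coev D) (A ⊗ w)).
rw (m_comm (D' ⊗ (A ⊗ w))); rw (cap_nat (sym D' A ∘ coev D) (cap k w)).
rwl (whiskl_eq A (swap_cap_r D' k w)); rw (whiskl_eq A (swapK A D' (A ⊗ w))).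
(* Here (κ2) moves the multiplication to the other leg of [k]; the zigzag then contracts the trace
   loop and leaves m k. *)
rw (mul_nat (alg_mul A) (sAD w)); rwl (k2 (D' ⊗ w)); rw (cap_nat k (c w)).
rw (whiskl_eq A (e w)); rw (cup_nat (ev D) (m w)); rw (zigzag (A ⊗ w)).
exact: k1.
Qed.

(** By (κ2), Σ tr(b x_i) y_i = Σ tr(x_i) y_i b, which is b by [tr_sep_idem]. *)
Lemma form_sep_idem_l w : t (A ⊗ w) ∘ A ◁ cap k w = id[_].
Proof.
have [_ k2] := proj1 (sep_idemP k) sk.
rewrite form_trace; rwl (k2 w); rw (counit_nat (trace_map D) (m w)).
by rw (tr_sep_idem (A ⊗ w)); rw (m_unitl w).
Qed.

(** The mirror image; here the second leg is traced, which uses the symmetry of [k]. *)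
Lemma form_sep_idem_r w : A ◁ t w ∘ cap k (A ⊗ w) = id[_].
Proof.
have [_ k2] := proj1 (sep_idemP k) sk.
have e : A ◁ tr w ∘ cap k w = u w.
  rewrite (swap_counit A (trace_map D) w).
  by rewrite -comp_assoc -cap_sym -(sep_idem_fix sk) tr_sep_idem.
rewrite form_trace; rw (k2 w); rwl (mul_nat (alg_mul A) (tr w)).
by rw (whiskl_eq A e); rw (m_unitr w).
Qed.

Lemma adj_iso : is_iso (adjoint_map D (trace_form D)).
Proof.
set a := pat (carrier A); set d := pat D'.
(* The inverse sends a functional φ to Σ x_i φ(y_i). *)
pose g : D' ~> A := runit A ∘ (id[A] ⊗₁ ev D) ∘ assoc A A D'
                    ∘ (k ⊗₁ id[D']) ∘ lunit_inv D'.
have gE w : map g w = A ◁ ev_ w ∘ cap k (D' ⊗ w).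
  rewrite /map /g.
  rewrite (hat_comp _ (pten pone d)) hat_lunit_inv comp_idr.
  rewrite (hat_comp _ (pten (pten a a) d)) hat_whiskr.
  rewrite (hat_comp _ (pten a (pten a d))) hat_assoc comp_idr.
  by rewrite (hat_comp _ (pten a pone)) hat_runit comp_idl hat_whiskl.
exists g; split.
- apply: (hat_inj (p := a) (q := a)) => w; rewrite (hat_comp _ d) hat_id.
  rewrite -[hat d a g w]/(map g w) -[hat a d _ w]/(adj w) gE adj_form.
  rw (cap_nat k (D' ◁ t w)); rw (cap_nat k (coev_ (A ⊗ w))).
  rw (whiskl_eq A (cup_nat (ev D) (t w))).
  by rw (whiskl_eq A (zigzag (A ⊗ w))); rw (form_sep_idem_r w).
- apply: (hat_inj (p := d) (q := d)) => w; rewrite (hat_comp _ a) hat_id.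
  rewrite -[hat d a g w]/(map g w) -[hat a d _ w]/(adj w) gE adj_form.
  rw (cap_nat (coev D) (A ◁ ev_ w)); rw (cap_nat (coev D) (cap k (D' ⊗ w))).
  rw (whiskl_eq D' (cup_nat (trace_form D) (ev_ w))).
  by rw (whiskl_eq D' (form_sep_idem_l (D' ⊗ w))); rw (zigzag_dual w).
Qed.

End FromIdempotent.

(** * From nondegeneracy to a separability idempotent *)

Section FromForm.
Context (g : D' ~> A).
Context (gK : g ∘ adjoint_map D (trace_form D) = id[A]).
Context (Kg : adjoint_map D (trace_form D) ∘ g = id[D']).

(** The coevaluation carried along the inverse of the adjoint map; with the trace form it makes [A]
    its own dual. *)
Definition copairing : 𝟙 ~> A ⊗ A := (g ⊗₁ id[A]) ∘ coev D.
Notation k := copairing.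

Lemma copairingE w : cap k w = map g (A ⊗ w) ∘ coev_ w.
Proof.
rewrite /cap /copairing (hat_comp _ (pten (pat D') (pat A))).
by rewrite hat_whiskr.
Qed.

Lemma map_gK w : map g w ∘ adj w = id[_].
Proof. exact: (hat_inv (pat (carrier A)) (pat D') w gK). Qed.

Lemma map_Kg w : adj w ∘ map g w = id[_].
Proof. exact: (hat_inv (pat D') (pat (carrier A)) w Kg). Qed.

(** The zigzag cancels the coevaluation contained in the adjoint map. *)
Lemma form_adj w : ev_ w ∘ A ◁ adj w = t w.
Proof.
by rewrite adj_form; rw (cup_nat (ev D) (t w)); rw (zigzag (A ⊗ w)).
Qed.

Lemma copairing_r w : A ◁ t w ∘ cap k (A ⊗ w) = id[_].
Proof.
by rewrite copairingE; rwl (map_nat g (t w)); rwl (adj_form w); rw (map_gK w).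
Qed.

Lemma copairing_l w : t (A ⊗ w) ∘ A ◁ cap k w = id[_].
Proof.
rewrite copairingE -form_adj; rw (whiskl_eq A (map_Kg (A ⊗ w))).
exact: zigzag.
Qed.

Lemma t_comm w : t w ∘ s w = t w.
Proof. by rewrite form_trace; rw (m_comm w). Qed.

(* A left and a right inverse of the same form coincide. *)
Lemma copairing_sym : k = sym A A ∘ k.
Proof.
apply: (hat_inj (p := pone) (q := pten (pat A) (pat A))) => w.
rewrite -[LHS]/(cap k w) -[RHS]/(cap (sym A A ∘ k) w).
have e : t (A ⊗ w) ∘ A ◁ cap (sym A A ∘ k) w = id[_].
  rewrite cap_sym -(copairing_r w); rwl (swap_cap A k w).
  rw (whiskl_eq A (t_comm w)); rw (swap_cup A (trace_form D) w).
  by rw (swapK A A (A ⊗ w)).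
rewrite -[RHS]comp_idl -(copairing_r (A ⊗ w)).
by rw (cap_nat k (cap (sym A A ∘ k) w)); rw (whiskl_eq A e).
Qed.

(** The form is associative, t(ab, c) = t(a, bc), and the copairing inverts it: Σ x_i ⊗ t(y_i, b
    x_j) y_j = Σ x_i ⊗ t(y_i b, x_j) y_j = Σ x_i ⊗ y_i b. *)
Lemma copairing_mul w : A ◁ m w ∘ cap k (A ⊗ w) = m (A ⊗ w) ∘ A ◁ cap k w.
Proof.
rewrite -[RHS]comp_idl -(copairing_r (A ⊗ w)).
rw (cap_nat k (m (A ⊗ w) ∘ A ◁ cap k w)).
rewrite form_trace; rwl (whiskl_eq A (m_assoc (A ⊗ w))).
rw (whiskl_eq A (mul_nat (alg_mul A) (cap k w))).
by rwl (whiskl_eq A (form_trace (A ⊗ w))); rw (whiskl_eq A (copairing_l w)).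
Qed.

(* Computing the trace with the copairing gives [tr b = t (b, m k)], while
   [tr b = t (b, 1)] by unitality. *)
Lemma copairing_mul_unit w : m w ∘ cap k w = u w.
Proof.
have coevE w' : coev_ w' = adj (A ⊗ w') ∘ cap k w'.
  by rewrite copairingE; rw (map_Kg (A ⊗ w')).
(* Symmetry of the copairing lets the adjoint map act on the second leg: the x_i and the adjoints of
   the y_i are dual bases. *)
have coev_swapE : c w = A ◁ adj w ∘ cap k w.
  rewrite coev_swap coevE; rw (swap_map A (adjoint_map D (trace_form D)) w).
  by rewrite -cap_sym -copairing_sym.
have e : t w ∘ A ◁ (m w ∘ cap k w) = t w ∘ A ◁ u w.
  rewrite [in RHS]form_trace; rw (m_unitr w); rewrite trace_coev coev_swapE.
  rw (mul_nat (alg_mul A) (adj w)); rw (form_adj w).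
  by rewrite form_trace; rwl (m_assoc w).
(* The identity [copairing_r] lets the form be cancelled from [e]. *)
rewrite -[LHS]comp_idl -[RHS]comp_idl -(copairing_r w).
by rw (cap_nat k (m w ∘ cap k w)); rw (whiskl_eq A e); rwl (cap_nat k (u w)).
Qed.

Lemma copairing_sep_idem : separability_idempotent k.
Proof.
by apply/sep_idemP; split=> w; [apply: copairing_mul_unit|apply: copairing_mul].
Qed.

End FromForm.
End Trace.

Theorem corollary2p38 (C : symmetric_monoidal_category) (A : algebra C)
    (commA : commutative A) (D : duality (carrier A)) :
  (separable A <-> strongly_separable A) /\
  (strongly_separable A <-> nondegenerate D (trace_form D)).
Proof.
split; split.
- by case/separableP=> k sk; exists k; split=> //; apply: sep_idem_fix.
- by case=> k [sk _]; apply/separableP; exists k.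
- by case=> k [sk _]; apply: adj_iso sk.
- case=> g [gK Kg]; exists (copairing g).
  by split; [apply: copairing_sep_idem | apply: copairing_sym].
Qed.
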